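(* Let $\Gamma$ be a variable typing environment and $\Delta$ a safe operator typing environment such that the multi-threaded programs $M$ and $N$ are well-typed. Assume $\mu\vDash M\approx_{\Gamma,\Delta}\sigma\vDash N$. If $\mu\vDash M\Rightarrow^t\mu'\vDash M'$, then there exist $\sigma'$ and $N'$ such that $\sigma\vDash N\Rightarrow^t\sigma'\vDash N'$ and $\mu'\vDash M'\approx_{\Gamma,\Delta}\sigma'\vDash N'$.
   Context: Words: $\mathcal{W}$ is the set of finite words over a finite alphabet $\Sigma$, containing distinguished words $\texttt{tt},\texttt{ff}$. Operators $op$ have fixed arity $n\ge0$ and are interpreted as total functions $[\![op]\!]:\mathcal{W}^n\to\mathcal{W}$. Expressions: $E ::= X \mid op(E_1,\dots,E_n)$. Commands: $C ::= X:=E \mid C;C' \mid \texttt{skip}\mid \texttt{if } E\texttt{ then } C\texttt{ else } C'\mid\texttt{while}(E)\{C\}$. A multi-threaded program $M$ is a finite map from thread identifiers to commands; $\emptyset$ is the empty program, $M-x$ the restriction to $\mathrm{dom}(M)\setminus\{x\}$, $M[x:=C]$ the update. A store maps variables to words. Expression evaluation $\mu\vDash E\Downarrow d$ is the obvious one ($X\mapsto\mu(X)$, $op(E_1,\dots,E_n)\mapsto[\![op]\!](d_1,\dots,d_n)$). Small-step relation $\to_s$ on configurations ($\mu\vDash C$ or a store): $\mu\vDash\texttt{skip}\to_s\mu$; $\mu\vDash X:=E\to_s\mu[X\leftarrow d]$ with $\mu\vDash E\Downarrow d$; if $\mu\vDash C_1\to_s\mu_1$ then $\mu\vDash C_1;C_2\to_s\mu_1\vDash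 C_2$; if $\mu\vDash C_1\to_s\mu_1\vDash C_1'$ then $\mu\vDash C_1;C_2\to_s\mu_1\vDash C_1';C_2$; if $E$ evaluates to $w\in\{\texttt{tt},\texttt{ff}\}$ then $\mu\vDash\texttt{if }E\texttt{ then }C_{\texttt{tt}}\texttt{ else }C_{\texttt{ff}}\to_s\mu\vDash C_w$; if $E$ evaluates to $\texttt{ff}$, $\mu\vDash\texttt{while}(E)\{C\}\to_s\mu$; if $E$ evaluates to $\texttt{tt}$, $\mu\vDash\texttt{while}(E)\{C\}\to_s\mu\vDash C;\texttt{while}(E)\{C\}$ (loop-unfolding rule). Global relation $\to_g$: if $M(x)=C$ and $\mu\vDash C\to_s\mu_1$ then $\mu\vDash M\to_g\mu_1\vDash M-x$; if $M(x)=C$ and $\mu\vDash C\to_s\mu_1\vDash C_1$ then $\mu\vDash M\to_g\mu_1\vDash M[x:=C_1]$ (any thread may be chosen). Loop-length relation: $\mu\vDash M\Rightarrow^t\mu'\vDash M'$ iff there is a finite sequence of $\to_g$-steps from $\mu\vDash M$ to $\mu'\vDash M'$ whose underlying $\to_s$-steps use the loop-unfolding rule exactly $t$ times in total. Tiers $\mathbf{0}\preceq\mathbf{1}$ with $\vee,\wedge$. $\Gamma$ maps variables to tiers; $\Delta$ maps each operator of arity $n$ to a set of types $\alpha_1\to\cdots\to\alpha_n\to\alpha$. Typing: $\Gamma,\Delta\vdash X:\Gamma(X)$; $op(E_1,\dots,E_n):\alpha$ if $E_i:\alpha_i$ and $\alpha_1\to\cdots\to\alpha_n\to\alpha\in\Delta(op)$;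 $X:=E:\beta$ if $X:\beta$, $E:\alpha$, $\beta\preceq\alpha$; $C;C':\alpha\vee\beta$ if $C:\alpha$, $C':\beta$; $\texttt{skip}:\alpha$ for any $\alpha$; $\texttt{if }E\texttt{ then }C\texttt{ else }C':\alpha$ if $E,C,C'$ all have type $\alpha$; $\texttt{while}(E)\{C\}:\mathbf{1}$ if $E:\mathbf{1}$ and $C:\alpha$ for some $\alpha$. $M$ is well-typed if each $M(x)$ has some tier. Neutral operator: $[\![op]\!]$ takes only values $\texttt{tt},\texttt{ff}$, or for all arguments the result is a sub-word (factor $w=uvu'$) of some argument. Positive operator: $|[\![op]\!](d_1,\dots,d_n)|\le\max_i|d_i|+c$ for a constant $c$. Standing assumption: every operator is neutral or positive. $\Delta$ is safe if every type $\alpha_1\to\cdots\to\alpha_n\to\alpha\in\Delta(op)$ satisfies $\alpha\preceq\bigwedge_i\alpha_i$, and $\alpha=\mathbf{0}$ if $op$ is positive but not neutral. Equivalence: $\mu\approx_{\Gamma,\Delta}\sigma$ iff $\mu(X)=\sigma(X)$ for all $X\in\mathrm{dom}(\Gamma)$ with $\Gamma(X)=\mathbf{1}$. On commands, $\approx$ is the least relation with: $C\approx C$; $C\approx C'$ whenever both have type $\mathbf{0}$; $C\approx C'$, $D\approx D'$ imply $C;D\approx C';D'$. On programs: $M\approx M'$ iff $\mathrm{dom}(M)=\mathrm{dom}(M')$ and $M(x)\approx M'(x)$ for all $x$. On configurations: $\mu\vDash M\approx\sigma\vDash M'$ iff $M\approx M'$ and $\mu\approx\sigma$.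
   Formalization: Added assumption: in no configuration reachable from σ⊨N does a thread face a tier-0 conditional whose guard evaluates to a word other than tt, ff. Without it the claim fails: M=N={x↦if X then skip else skip}, Γ(X)=0, μ(X)=tt, σ(X)∉{tt,ff}. *)

(* Defs.v *)
From HB Require Import structures.
From mathcomp Require Import all_boot all_order.
From mathcomp Require Import finmap.

Set Implicit Arguments.
Unset Strict Implicit.
Unset Printing Implicit Defensive.

Local Open Scope fset_scope.
Local Open Scope fmap_scope.

(* An operator of arity n is a total function on n-families of words; the
   words wtt and wff are the truth values. *)
Record language := Language {
  letter : finType;
  var : eqType;
  tid : choiceType;
  oper : Type;
  arity : oper -> nat;
  interp : forall o : oper, {ffun 'I_(arity o) -> seq letter} -> seq letter;
  wtt : seq letter;
  wff : seq letter
}.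

Arguments wtt {l}.
Arguments wff {l}.

Definition word (L : language) := seq (letter L).

Section Syntax.

Variable L : language.

Inductive expr :=
| Var (X : var L)
| App (o : oper L) (Es : {ffun 'I_(arity o) -> expr}).

Inductive cmd :=
| Assign (X : var L) (E : expr)
| Seq (C D : cmd)
| Skip
| If (E : expr) (C D : cmd)
| While (E : expr) (C : cmd).

Definition program := {fmap tid L -> cmd}.

End Syntax.

Arguments Skip {L}.

Section Semantics.

Variable L : language.
Implicit Types (E : expr L) (C D : cmd L) (M : program L).

Definition store := var L -> word L.

Implicit Types mu : store.

Definition update mu (X : var L) (d : word L) : store :=
  fun Y => if Y == X then d else mu Y.

Fixpoint eval mu (E : expr L) : word L :=
  match E with
  | Var X => mu X
  | App o Es => interp [ffun i => eval mu (Es i)]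
  end.

Inductive conf :=
| Final (mu : store)
| Running (mu : store) (C : cmd L).

(* The natural number counts the uses of the loop-unfolding rule in the
   derivation of the step (it is 0 or 1). *)
Inductive step : store -> cmd L -> nat -> conf -> Prop :=
| step_skip mu : step mu Skip 0 (Final mu)
| step_assign mu X E :
    step mu (Assign X E) 0 (Final (update mu X (eval mu E)))
| step_seq_final mu C D k mu1 :
    step mu C k (Final mu1) -> step mu (Seq C D) k (Running mu1 D)
| step_seq_running mu C D k mu1 C1 :
    step mu C k (Running mu1 C1) ->
    step mu (Seq C D) k (Running mu1 (Seq C1 D))
| step_if_tt mu E C D :
    eval mu E = wtt -> step mu (If E C D) 0 (Running mu C)
| step_if_ff mu E C D :
    eval mu E = wff -> step mu (If E C D) 0 (Running mu D)
| step_while_ff mu E C :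
    eval mu E = wff -> step mu (While E C) 0 (Final mu)
| step_while_tt mu E C :
    eval mu E = wtt ->
    step mu (While E C) 1 (Running mu (Seq C (While E C))).

Inductive gstep : store -> program L -> nat -> store -> program L -> Prop :=
| gstep_final mu M x C k mu1 :
    M.[? x] = Some C -> step mu C k (Final mu1) ->
    gstep mu M k mu1 M.[~ x]
| gstep_running mu M x C k mu1 C1 :
    M.[? x] = Some C -> step mu C k (Running mu1 C1) ->
    gstep mu M k mu1 M.[x <- C1].

(* [exec mu M t mu' M']: finitely many global steps lead from (mu, M) to
   (mu', M'), with exactly t loop unfoldings in total. *)
Inductive exec : store -> program L -> nat -> store -> program L -> Prop :=
| exec_refl mu M : exec mu M 0 mu M
| exec_step mu M k mu1 M1 t mu2 M2 :
    gstep mu M k mu1 M1 -> exec mu1 M1 t mu2 M2 ->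
    exec mu M (k + t) mu2 M2.

End Semantics.

(* Tiers are ordered as bool is: false <= true. *)
Notation tier := bool (only parsing).
Notation T0 := false (only parsing).
Notation T1 := true (only parsing).

Definition var_env (L : language) := var L -> option tier.

(* [Delta o alpha a] states that alpha_1 -> ... -> alpha_n -> a is one of the
   types that Delta assigns to o. *)
Definition op_env (L : language) :=
  forall o : oper L, {ffun 'I_(arity o) -> tier} -> tier -> Prop.

Section Typing.

Variables (L : language) (Gamma : var_env L) (Delta : op_env L).

Inductive typed_expr : expr L -> tier -> Prop :=
| typed_var X a : Gamma X = Some a -> typed_expr (Var X) a
| typed_app (o : oper L) (Es : {ffun 'I_(arity o) -> expr L})
    (alpha : {ffun 'I_(arity o) -> tier}) (a : tier) :
    (forall i, typed_expr (Es i) (alpha i)) -> Delta alpha a ->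
    typed_expr (App Es) a.

Inductive typed_cmd : cmd L -> tier -> Prop :=
| typed_assign X E a b :
    Gamma X = Some b -> typed_expr E a -> (b <= a)%O ->
    typed_cmd (Assign X E) b
| typed_seq C D a b :
    typed_cmd C a -> typed_cmd D b -> typed_cmd (Seq C D) (a `|` b)%O
| typed_skip a : typed_cmd Skip a
| typed_if E C D a :
    typed_expr E a -> typed_cmd C a -> typed_cmd D a ->
    typed_cmd (If E C D) a
| typed_while E C a :
    typed_expr E T1 -> typed_cmd C a -> typed_cmd (While E C) T1.

Definition well_typed (M : program L) : Prop :=
  forall x C, M.[? x] = Some C -> exists a, typed_cmd C a.

Definition neutral (o : oper L) : Prop :=
  (forall d : {ffun 'I_(arity o) -> word L},
     interp d = wtt \/ interp d = wff) \/
  (forall d : {ffun 'I_(arity o) -> word L},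
     exists i, infix (interp d) (d i)).

Definition positive (o : oper L) : Prop :=
  exists c : nat, forall d : {ffun 'I_(arity o) -> word L},
    size (interp d) <= \max_(i < arity o) size (d i) + c.

Definition safe : Prop :=
  forall (o : oper L) (alpha : {ffun 'I_(arity o) -> tier}) (a : tier),
    Delta alpha a ->
    (a <= \meet_(i < arity o) alpha i)%O /\
    (positive o -> ~ neutral o -> a = T0).

Definition store_equiv (mu sigma : store L) : Prop :=
  forall X, Gamma X = Some T1 -> mu X = sigma X.

Inductive cmd_equiv : cmd L -> cmd L -> Prop :=
| cmd_equiv_refl C : cmd_equiv C C
| cmd_equiv_tier0 C D :
    typed_cmd C T0 -> typed_cmd D T0 -> cmd_equiv C D
| cmd_equiv_seq C C' D D' :
    cmd_equiv C C' -> cmd_equiv D D' -> cmd_equiv (Seq C D) (Seq C' D').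

Definition program_equiv (M N : program L) : Prop :=
  domf M = domf N /\
  forall x C D, M.[? x] = Some C -> N.[? x] = Some D -> cmd_equiv C D.

Definition conf_equiv (mu : store L) (M : program L)
    (sigma : store L) (N : program L) : Prop :=
  program_equiv M N /\ store_equiv mu sigma.

(* [blocked0 sigma C]: the next thing that C has to execute is a conditional
   of tier 0, and its guard does not evaluate to a truth value. *)
Inductive blocked0 (sigma : store L) : cmd L -> Prop :=
| blocked0_if E C D :
    typed_cmd (If E C D) T0 -> eval sigma E <> wtt -> eval sigma E <> wff ->
    blocked0 sigma (If E C D)
| blocked0_seq C D : blocked0 sigma C -> blocked0 sigma (Seq C D).

(* Guards are meant to denote truth values, but no rule above enforces it: with
   X of tier 0, the thread If X Skip Skip terminates if X holds wtt and is stuck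
   forever if X holds a word other than wtt and wff.  Stores that differ only on
   tier 0 variables would thus be distinguished. *)
Definition never_blocked0 (sigma : store L) (N : program L) : Prop :=
  forall t sigma1 N1, exec sigma N t sigma1 N1 ->
  forall x C, N1.[? x] = Some C -> ~ blocked0 sigma1 C.

End Typing.

(* Main.v *)
(** The two programs run in lockstep on commands of tier 1, whose guards and
    assigned expressions only read variables of tier 1.  A command of tier 0
    contains no loop and writes no variable of tier 1: a step of the left
    program inside it is matched by no step at all, and its termination by
    running the equivalent command of the right program to its end. *)
Require Import Defs.
From mathcomp Require Import all_boot all_order finmap.

Set Implicit Arguments.
Unset Strict Implicit.
Unset Printing Implicit Defensive.

Import Order.TTheory.

(** * Runs of a single thread and their embedding into program executions *)

Section Run.

Variable L : language.
Implicit Types (mu sigma : store L) (C D : cmd L) (M N : program L) (c : conf L).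

(** Any number of steps of one thread in isolation, with the total number of loop unfoldings: one
    step on the left may be answered by none or by many. *)
Inductive run : store L -> cmd L -> nat -> conf L -> Prop :=
| run_refl mu C : run mu C 0 (Running mu C)
| run_final mu C k mu1 : step mu C k (Final mu1) -> run mu C k (Final mu1)
| run_step mu C k mu1 C1 t c :
    step mu C k (Running mu1 C1) -> run mu1 C1 t c -> run mu C (k + t) c.

Lemma step_run mu C k c : step mu C k c -> run mu C k c.
Proof.
case: c => [mu1|mu1 C1] st; first exact: run_final.
by rewrite -(addn0 k); apply: run_step st (run_refl _ _).
Qed.

Lemma run_trans mu C k mu1 C1 t c :
  run mu C k (Running mu1 C1) -> run mu1 C1 t c -> run mu C (k + t) c.
Proof.
move Ec1: (Running mu1 C1) => c1 r.
elim: r Ec1 => {mu C k c1} [mu C [-> ->] //|//|mu C k mu2 C2 s c' st _ IH Ec r].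
by rewrite -addnA; apply: run_step st (IH Ec r).
Qed.

(** The sequencing rules only wrap the left component, so a run of [C] lifts step by step, and its
    end hands over to [D]. *)
Lemma run_seq mu C t c D :
  run mu C t c ->
  run mu (Seq C D) t
    match c with
    | Final mu1 => Running mu1 D
    | Running mu1 C1 => Running mu1 (Seq C1 D)
    end.
Proof.
elim=> {mu C t c} [mu C|mu C k mu1 st|mu C k mu1 C1 t c st _ IH].
- exact: run_refl.
- by apply: step_run; apply: step_seq_final.
- by apply: run_step IH; apply: step_seq_running.
Qed.

Definition conf_store c := match c with Final mu => mu | Running mu _ => mu end.

Definition conf_cmd c := if c is Running _ C then Some C else None.

(** Merges the two global rules: a finished thread is removed, a running one is updated. *)
Definition resume M (x : tid L) c : program L :=
  if conf_cmd c is Some C then M.[x <- C]%fmap else M.[~ x]%fmap.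

Lemma resume_fnd M x c y :
  (resume M x c).[? y]%fmap = if y == x then conf_cmd c else M.[? y]%fmap.
Proof.
rewrite /resume; case: (conf_cmd c) => [C|]; first by rewrite fnd_set.
by rewrite fnd_rem1; case: eqP.
Qed.

Lemma gstep_resume M x C mu k c :
  M.[? x]%fmap = Some C -> step mu C k c ->
  gstep mu M k (conf_store c) (resume M x c).
Proof.
by case: c => [mu1|mu1 C1] Mx st; [apply: gstep_final Mx st | apply: gstep_running Mx st].
Qed.

Lemma gstepP mu M k mu1 M1 :
  gstep mu M k mu1 M1 ->
  exists x C c, [/\ M.[? x]%fmap = Some C, step mu C k c,
    mu1 = conf_store c & M1 = resume M x c].
Proof.
case=> {mu M k mu1 M1} [mu M x C k mu1 Mx st|mu M x C k mu1 C1 Mx st].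
  by exists x, C, (Final mu1).
by exists x, C, (Running mu1 C1).
Qed.

(** The scheduler is free to pick the thread [x] again and again. *)
Lemma exec_run M x C mu t c :
  M.[? x]%fmap = Some C -> run mu C t c ->
  exec mu M t (conf_store c) (resume M x c).
Proof.
move=> Mx r; elim: r M Mx => {mu C t c} [mu C|mu C k mu1 st|mu C k mu1 C1 t c st _ IH] M Mx.
- suff -> : resume M x (Running mu C) = M by exact: exec_refl.
  by apply/fmapP => y; rewrite resume_fnd; case: eqP => // ->.
- rewrite -(addn0 k); apply: exec_step (exec_refl _ _).
  exact: gstep_resume Mx st.
- suff -> : resume M x c = resume (resume M x (Running mu1 C1)) x c.
    apply: exec_step (gstep_resume Mx st) (IH _ _).
    by rewrite resume_fnd eqxx.
  by apply/fmapP => y; rewrite !resume_fnd; case: eqP.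
Qed.

Lemma exec_trans mu M s mu1 M1 t mu2 M2 :
  exec mu M s mu1 M1 -> exec mu1 M1 t mu2 M2 -> exec mu M (s + t) mu2 M2.
Proof.
elim=> {mu M s mu1 M1} [//|mu M k mu1 M1 s mu2' M2' st _ IH r].
by rewrite -addnA; apply: exec_step st (IH r).
Qed.

End Run.

(** * Tiers under evaluation and single steps *)

Section NonInterference.

Variables (L : language) (Gamma : var_env L) (Delta : op_env L).
Hypothesis Delta_safe : safe Delta.
Implicit Types (mu sigma : store L) (C D : cmd L) (M N : program L) (c : conf L).

Local Notation typed_expr := (typed_expr Gamma Delta).
Local Notation typed_cmd := (typed_cmd Gamma Delta).
Local Notation store_equiv := (store_equiv Gamma).
Local Notation cmd_equiv := (cmd_equiv Gamma Delta).
Local Notation well_typed := (well_typed Gamma Delta).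
Local Notation never_blocked0 := (never_blocked0 Gamma Delta).

(** Safety bounds the result tier of an operator by the meet of its argument tiers, so tier 1
    propagates down to every variable of [E]. *)
Lemma eval_equiv mu sigma E :
  typed_expr E true -> store_equiv mu sigma -> eval mu E = eval sigma E.
Proof.
move=> + eqv; move Ea: true => a tE.
elim: tE Ea => {E a} [X a GX Ea|o Es alpha a _ IH Da Ea] /=; first by rewrite eqv // GX -Ea.
congr interp; apply/ffunP => i; rewrite !ffunE; apply: IH.
have [+ _] := Delta_safe Da; rewrite -Ea => /meetsP /(_ i isT).
by case: (alpha i).
Qed.

Lemma typed_seq_inv C D a :
  typed_cmd (Seq C D) a ->
  exists a1 a2, [/\ a = (a1 `|` a2)%O, typed_cmd C a1 & typed_cmd D a2].
Proof. by move=> tCD; inversion tCD; subst; eexists; eexists; split; eauto. Qed.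

Lemma typed_seq0 C D :
  typed_cmd (Seq C D) false -> typed_cmd C false /\ typed_cmd D false.
Proof. by move=> /typed_seq_inv [[] [[] [//]]]. Qed.

(** The tier can drop: once the first component of a sequence ends, only the tier of the second
    remains. *)
Lemma subject_reduction mu C k mu1 C1 a :
  step mu C k (Running mu1 C1) -> typed_cmd C a ->
  exists2 b, (b <= a)%O & typed_cmd C1 b.
Proof.
move Ec: (Running mu1 C1) => c st.
elim: st mu1 C1 a Ec => // {mu C k c}.
- move=> mu C D k mu1 _ _ mu1' C1 a [_ ->] /typed_seq_inv [a1 [a2 [-> _ tD]]].
  by exists a2 => //; apply: leUr.
- move=> mu C D k mu1 C1 _ IH mu1' C1' a [_ ->].
  move=> /typed_seq_inv [a1 [a2 [-> tC tD]]].
  have [b ba tC1] := IH _ _ _ erefl tC.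
  by exists (b `|` a2)%O; [apply: leU2 | apply: typed_seq].
- by move=> mu E C D _ mu1 C1 a [_ ->] tI; inversion tI; subst; exists a.
- by move=> mu E C D _ mu1 C1 a [_ ->] tI; inversion tI; subst; exists a.
- move=> mu E C _ mu1 C1 a [_ ->] tW; inversion tW as [| | | |? ? b _ tC]; subst.
  (* The tier 1 of the loop absorbs the tier [b] of its body. *)
  by exists true => //; rewrite -[true](joinx1 b); apply: typed_seq.
Qed.

(** Loops have tier 1, so none is unfolded here, and an assignment has the tier of its variable. *)
Lemma step0_store mu C k c :
  step mu C k c -> typed_cmd C false -> k = 0 /\ store_equiv mu (conf_store c).
Proof.
elim=> {mu C k c} //=.
- move=> mu X E tA; split=> // Y GY; rewrite /update; case: eqP => // EY.
  by inversion tA; subst; congruence.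
- by move=> mu C D k mu1 _ IH /typed_seq0 [/IH].
- by move=> mu C D k mu1 C1 _ IH /typed_seq0 [/IH].
- by move=> mu E C _ tW; inversion tW.
Qed.

(** * Termination of tier 0 commands *)

(** The counterpart of [never_blocked0] for a thread running alone; it passes to left components and
    along runs, as the inductions below require. *)
Definition unblocked sigma C :=
  forall t sigma1 C1, run sigma C t (Running sigma1 C1) ->
  ~ blocked0 Gamma Delta sigma1 C1.

Lemma unblocked_seq sigma C D : unblocked sigma (Seq C D) -> unblocked sigma C.
Proof.
move=> ub t sigma1 C1 /(run_seq D) r bl.
exact: ub r (blocked0_seq _ bl).
Qed.

Lemma unblocked_run sigma C t sigma1 C1 :
  unblocked sigma C -> run sigma C t (Running sigma1 C1) -> unblocked sigma1 C1.
Proof. by move=> ub r s sigma2 C2 /(run_trans r); apply: ub. Qed.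

(** Without loops, structural induction on [C] proves termination; the only way to get stuck is a
    guard that is no truth value, which [unblocked] excludes. *)
Lemma run0_final sigma C :
  typed_cmd C false -> unblocked sigma C ->
  exists2 sigma1, run sigma C 0 (Final sigma1) & store_equiv sigma sigma1.
Proof.
elim: C sigma => [X E|C IHC D IHD||E C IHC D IHD|E C _] sigma tC ub.
- exists (update sigma X (eval sigma E)).
    by apply: run_final; apply: step_assign.
  exact: (step0_store (step_assign _ _ _) tC).2.
- have [tC0 tD0] := typed_seq0 tC.
  have [sigma1 /(run_seq D) r1 e1] := IHC _ tC0 (unblocked_seq ub).
  have [sigma2 r2 e2] := IHD _ tD0 (unblocked_run ub r1).
  by exists sigma2 => [|X GX]; [apply: run_trans r1 r2 | rewrite e1 // e2].
- by exists sigma => //; apply: run_final; apply: step_skip.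
- have [tC0 tD0] : typed_cmd C false /\ typed_cmd D false by inversion tC.
  have go B : typed_cmd B false -> step sigma (If E C D) 0 (Running sigma B) ->
      (forall s, typed_cmd B false -> unblocked s B ->
        exists2 s1, run s B 0 (Final s1) & store_equiv s s1) ->
      exists2 s1, run sigma (If E C D) 0 (Final s1) & store_equiv sigma s1.
    move=> tB /step_run r IHB.
    have [s1 r1 e1] := IHB _ tB (unblocked_run ub r).
    by exists s1 => //; apply: run_trans r r1.
  have [Ett|Ntt] := eqVneq (eval sigma E) wtt.
    by apply: go tC0 _ IHC; apply: step_if_tt.
  have [Eff|Nff] := eqVneq (eval sigma E) wff.
    by apply: go tD0 _ IHD; apply: step_if_ff.
  (* The conditional would be blocked already at the start of the run. *)
  case: (ub _ _ _ (run_refl _ _)).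
  by apply: blocked0_if => //; apply/eqP.
- by inversion tC.
Qed.

(** * Simulation of the steps of one thread *)

Definition local_equiv c c' :=
  store_equiv (conf_store c) (conf_store c') /\
  match conf_cmd c, conf_cmd c' with
  | Some C, Some C' => cmd_equiv C C'
  | None, None => True
  | _, _ => False
  end.

Lemma tier0_simulation mu C k c sigma C' :
  step mu C k c -> typed_cmd C false -> typed_cmd C' false ->
  store_equiv mu sigma -> unblocked sigma C' ->
  exists2 c', run sigma C' k c' & local_equiv c c'.
Proof.
move=> st tC tC' eqv ub; have [k0 eq1] := step0_store st tC.
rewrite k0; case: c st eq1 => [mu1|mu1 C1] st /= eq1.
  have [sigma1 r e] := run0_final tC' ub.
  by exists (Final sigma1) => //; split=> // X GX /=; rewrite -e // -eqv // eq1.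
exists (Running sigma C'); first exact: run_refl.
split=> [X GX|] /=; first by rewrite -eqv // eq1.
(* A tier below 0 is 0, so [C1] is still equivalent to the unmoved [C']. *)
have [[] // _ tC1] := subject_reduction st tC.
exact: cmd_equiv_tier0.
Qed.

Lemma cmd_equiv_inv C C' :
  cmd_equiv C C' ->
  [\/ typed_cmd C false /\ typed_cmd C' false, C = C' |
     exists A A' B B', [/\ C = Seq A B, C' = Seq A' B',
       cmd_equiv A A' & cmd_equiv B B']].
Proof.
case=> {C C'} [C|C C' tC tC'|A A' B B' eA eB].
- by constructor 2.
- by constructor 1.
- by constructor 3; exists A, A', B, B'.
Qed.

(** Reflexivity is absorbed by the componentwise case, which leaves two cases. *)
Lemma cmd_equiv_seql A B C' :
  cmd_equiv (Seq A B) C' ->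
  (typed_cmd (Seq A B) false /\ typed_cmd C' false) \/
  exists A' B', [/\ C' = Seq A' B', cmd_equiv A A' & cmd_equiv B B'].
Proof.
case/cmd_equiv_inv => [|<-|[A1 [A' [B1 [B' [[-> ->] -> eA eB]]]]]].
- by left.
- by right; exists A, B; split=> //; apply: cmd_equiv_refl.
- by right; exists A', B'.
Qed.

(** Induction on the derivation of the step. Pairs of tier 0 commands go to [tier0_simulation];
    otherwise the commands are equal, or are sequences treated by induction on the left
    component. *)
Lemma step_simulation mu C k c a a' sigma C' :
  step mu C k c -> typed_cmd C a -> typed_cmd C' a' -> cmd_equiv C C' ->
  store_equiv mu sigma -> unblocked sigma C' ->
  exists2 c', run sigma C' k c' & local_equiv c c'.
Proof.
(* The copy of [st] keeps the step of the whole command available for [tier0_simulation]. *)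
move=> st; elim: st (st) a a' sigma C' => {mu C k c}.
- move=> mu st a a' sigma C' tC tC' /cmd_equiv_inv [[]||[? [? [? [? []]]]]] //.
    by move=> t0 t0' eqv ub; apply: tier0_simulation st t0 t0' eqv ub.
  move=> <- eqv ub; exists (Final sigma) => //.
  by apply: run_final; apply: step_skip.
- move=> mu X E st a a' sigma C' tC tC' /cmd_equiv_inv [[]||[? [? [? [? []]]]]] //.
    by move=> t0 t0' eqv ub; apply: tier0_simulation st t0 t0' eqv ub.
  move=> <- eqv ub; case: a tC => tC; last exact: (tier0_simulation st tC tC eqv ub).
  exists (Final (update sigma X (eval sigma E))).
    by apply: run_final; apply: step_assign.
  split=> // Y GY /=; rewrite /update; case: eqP => // _; last exact: eqv.
  (* [le] forces tier 1 on [E], so both sides write the same word. *)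
  inversion tC as [? ? [] ? _ tE le| | | |] => //; subst; first exact: eval_equiv eqv.
- move=> mu C D k mu1 sC IH st a a' sigma C' tC tC' /cmd_equiv_seql [[]|].
    by move=> t0 t0' eqv ub; apply: tier0_simulation st t0 t0' eqv ub.
  move=> [A' [B' [EC' eA eB]]] eqv ub; move: tC' ub; rewrite EC' => tC' ub.
  have [a1 [_ [_ tA _]]] := typed_seq_inv tC.
  have [a1' [_ [_ tA' _]]] := typed_seq_inv tC'.
  have [[s1|? ?] r [e //= _]] := IH sC _ _ _ _ tA tA' eA eqv (unblocked_seq ub).
  by exists (Running s1 B') => //; apply: run_seq r.
- move=> mu C D k mu1 C1 sC IH st a a' sigma C' tC tC' /cmd_equiv_seql [[]|].
    by move=> t0 t0' eqv ub; apply: tier0_simulation st t0 t0' eqv ub.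
  move=> [A' [B' [EC' eA eB]]] eqv ub; move: tC' ub; rewrite EC' => tC' ub.
  have [a1 [_ [_ tA _]]] := typed_seq_inv tC.
  have [a1' [_ [_ tA' _]]] := typed_seq_inv tC'.
  have [[?|s1 C1'] r [e //= eC1]] := IH sC _ _ _ _ tA tA' eA eqv (unblocked_seq ub).
  exists (Running s1 (Seq C1' B')); first exact: run_seq r.
  by split=> //; apply: cmd_equiv_seq.
- move=> mu E C D Ett st a a' sigma C' tC tC' /cmd_equiv_inv [[]||[? [? [? [? []]]]]] //.
    by move=> t0 t0' eqv ub; apply: tier0_simulation st t0 t0' eqv ub.
  (* Even identical conditionals may branch differently at tier 0, hence the split on [a]. *)
  move=> <- eqv ub; case: a tC => tC; last exact: (tier0_simulation st tC tC eqv ub).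
  exists (Running sigma C); last by split=> //; apply: cmd_equiv_refl.
  apply: step_run; apply: step_if_tt; rewrite -Ett; symmetry.
  by inversion tC; subst; apply: eval_equiv eqv.
- move=> mu E C D Eff st a a' sigma C' tC tC' /cmd_equiv_inv [[]||[? [? [? [? []]]]]] //.
    by move=> t0 t0' eqv ub; apply: tier0_simulation st t0 t0' eqv ub.
  move=> <- eqv ub; case: a tC => tC; last exact: (tier0_simulation st tC tC eqv ub).
  exists (Running sigma D); last by split=> //; apply: cmd_equiv_refl.
  apply: step_run; apply: step_if_ff; rewrite -Eff; symmetry.
  by inversion tC; subst; apply: eval_equiv eqv.
- move=> mu E C Eff st a a' sigma C' tC tC' /cmd_equiv_inv [[]||[? [? [? [? []]]]]] //.
    (* A loop never has tier 0, so both sides are the same loop, with a guard of tier 1. *)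
    by move=> t0; inversion t0.
  move=> <- eqv ub; exists (Final sigma) => //.
  apply: step_run; apply: step_while_ff; rewrite -Eff; symmetry.
  by inversion tC; subst; apply: eval_equiv eqv.
- move=> mu E C Ett st a a' sigma C' tC tC' /cmd_equiv_inv [[]||[? [? [? [? []]]]]] //.
    by move=> t0; inversion t0.
  move=> <- eqv ub; exists (Running sigma (Seq C (While E C))).
    apply: step_run; apply: step_while_tt; rewrite -Ett; symmetry.
    by inversion tC; subst; apply: eval_equiv eqv.
  by split=> //; apply: cmd_equiv_refl.
Qed.

(** * Simulation of global steps and of executions *)

Lemma well_typed_gstep mu M k mu1 M1 :
  well_typed M -> gstep mu M k mu1 M1 -> well_typed M1.
Proof.
move=> tM /gstepP [x [C [c [Mx st _ ->]]]] y D; rewrite resume_fnd.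
case: eqP => [_|_]; last exact: tM.
case: c st => [//|mu2 C2] st [<-]; have [a tC] := tM _ _ Mx.
by have [b _ tC2] := subject_reduction st tC; exists b.
Qed.

Lemma well_typed_exec mu M t mu1 M1 :
  well_typed M -> exec mu M t mu1 M1 -> well_typed M1.
Proof.
move=> tM r; elim: r tM => // mu2 M2 k mu3 M3 s mu4 M4 st _ IH tM2.
exact: IH (well_typed_gstep tM2 st).
Qed.

Lemma never_blocked0_exec sigma N t sigma1 N1 :
  never_blocked0 sigma N -> exec sigma N t sigma1 N1 -> never_blocked0 sigma1 N1.
Proof. by move=> nb r s sigma2 N2 /(exec_trans r); apply: nb. Qed.

(** Running the thread [x] alone is one of the executions of [N]. *)
Lemma never_blocked0_unblocked sigma N x C :
  never_blocked0 sigma N -> N.[? x]%fmap = Some C -> unblocked sigma C.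
Proof.
move=> nb Nx t sigma1 C1 /(exec_run Nx) r; apply: (nb _ _ _ r x C1).
by rewrite resume_fnd eqxx.
Qed.

Lemma program_equiv_resume M N x c c' :
  program_equiv Gamma Delta M N -> local_equiv c c' ->
  program_equiv Gamma Delta (resume M x c) (resume N x c').
Proof.
move=> [dMN eMN] [_ ecc']; split=> [|y C D].
  rewrite /resume; case: (conf_cmd c) (conf_cmd c') ecc' => [C|] [C'|] // _.
    by rewrite !dom_setf dMN.
  by rewrite !domf_rem dMN.
rewrite !resume_fnd; case: eqP => _; last exact: eMN.
by move: ecc' => /[swap] -> /[swap] ->.
Qed.

(** The right program schedules the same thread [x], which exists there because the domains
    agree. *)
Lemma gstep_simulation mu M k mu1 M1 sigma N :
  well_typed M -> well_typed N -> conf_equiv Gamma Delta mu M sigma N ->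
  never_blocked0 sigma N -> gstep mu M k mu1 M1 ->
  exists sigma1 N1, exec sigma N k sigma1 N1 /\
    conf_equiv Gamma Delta mu1 M1 sigma1 N1.
Proof.
move=> tM tN [eMN eqv] nb /gstepP [x [C [c [Mx st -> ->]]]].
have [C' Nx] : exists C', N.[? x]%fmap = Some C'.
  have := fndP N x; case=> [xN|]; first by exists N.[xN]%fmap.
  by rewrite -eMN.1 => /not_fnd; rewrite Mx.
have [[a tC] [a' tC']] := (tM _ _ Mx, tN _ _ Nx).
have [c' r ecc'] := step_simulation st tC tC' (eMN.2 _ _ _ Mx Nx) eqv
  (never_blocked0_unblocked nb Nx).
exists (conf_store c'), (resume N x c'); split; first exact: exec_run Nx r.
by split; [apply: program_equiv_resume | case: ecc'].
Qed.

End NonInterference.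

Theorem theorem4 (L : language)
    (oper_ok : forall o : oper L, neutral o \/ positive o)
    (Gamma : var_env L) (Delta : op_env L) (Delta_safe : safe Delta)
    (M N : program L)
    (M_typed : well_typed Gamma Delta M) (N_typed : well_typed Gamma Delta N)
    (mu sigma : store L)
    (MN : conf_equiv Gamma Delta mu M sigma N)
    (N_guards : never_blocked0 Gamma Delta sigma N)
    (t : nat) (mu' : store L) (M' : program L)
    (execM : exec mu M t mu' M') :
  exists (sigma' : store L) (N' : program L),
    exec sigma N t sigma' N' /\ conf_equiv Gamma Delta mu' M' sigma' N'.
Proof.
(* Generalizing the right configuration lets each left step be answered by a whole execution, along
   which typing and [never_blocked0] persist. *)
elim: execM sigma N M_typed N_typed MN N_guards
  => {mu M t mu' M'} [mu M|mu M k mu1 M1 t mu2 M2 st _ IH] sigma N tM tN MN nb.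
  by exists sigma, N; split=> //; apply: exec_refl.
have [sigma1 [N1 [r1 eqv1]]] := gstep_simulation Delta_safe tM tN MN nb st.
have [sigma2 [N2 [r2 eqv2]]] := IH _ _ (well_typed_gstep tM st)
  (well_typed_exec tN r1) eqv1 (never_blocked0_exec nb r1).
by exists sigma2, N2; split=> //; apply: exec_trans r1 r2.
Qed.
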